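(* Let $p$ be a prime, $n\ge1$ an integer, and let $G$ be a periodic GGS-group (i.e. every element of $G$ has finite order) over the $p^n$-adic tree with defining vector $\mathbf{e}\in\mathcal{F}(p^n)$. Then $G$ is regular branch over $\gamma_3(G)$.
   Context: Let $m=p^n$ and $X=\{x_1,\dots,x_m\}$. The $p^n$-adic tree $\mathcal{T}$ is the rooted tree whose vertices are the words of the free monoid $X^*$ (root: the empty word), with $u$ and $ux$ joined by an edge for $u\in X^*$, $x\in X$; the $\ell$-th level is the set of words of length $\ell$. $\mathrm{Aut}\,\mathcal{T}$ is the group of automorphisms of $\mathcal{T}$; products are composed left to right. For $f\in\mathrm{Aut}\,\mathcal{T}$ and $u\in X^*$, the section $f_u$ is defined by $f(uz)=f(u)f_u(z)$ for all $z\in X^*$. $\mathrm{st}(1)$ is the pointwise stabilizer of the first level, and $\psi:\mathrm{st}(1)\to(\mathrm{Aut}\,\mathcal{T})^{m}$, $\psi(f)=(f_{x_1},\dots,f_{x_m})$, is an isomorphism. For $G\le\mathrm{Aut}\,\mathcal{T}$ put $\mathrm{st}_G(1)=\mathrm{st}(1)\cap G$. $\gamma_i$ denotes the terms of the lower central series. GGS-groups: given a non-zero $\mathbf{e}=(e_1,\dots,e_{p^n-1})\in(\mathbb{Z}/p^n\mathbb{Z})^{p^n-1}$, the GGS-group with defining vector $\mathbf{e}$ is $G=\langle a,b\rangle$, where $a$ is the rooted automorphism $a(x_iz)=x_{i+1}z$ (indices modulo $p^n$, $z\in X^*$) and $b\in\mathrm{st}(1)$ is defined recursively by $\psi(b)=(a^{e_1},\dots,a^{e_{p^n-1}},b)$.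 $\mathcal{F}(p^n)=(\mathbb{Z}/p^n\mathbb{Z})^{p^n-1}\setminus(p\mathbb{Z}/p^n\mathbb{Z})^{p^n-1}$. Branching: $G$ is regular branch over a subgroup $K$ if $G$ is transitive on every level, $g_u\in G$ for all $g\in G$, $u\in X^*$, $1\ne K\le\mathrm{st}_G(1)$, $K\times\overset{m}{\cdots}\times K\subseteq\psi(K)$, and $|G:K|$ is finite. *)

(* Defs.v *)
From HB Require Import structures.
From mathcomp Require Import all_boot all_algebra.
From mathcomp Require Import boolp classical_sets functions cardinality.

Set Implicit Arguments.
Unset Strict Implicit.
Unset Printing Implicit Defensive.

Import GRing.Theory.

Local Open Scope classical_set_scope.
Local Open Scope group_scope.

Section Subgroups.
Variable gT : groupType.
Implicit Types (A B G H K : set gT) (g : gT).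

Definition subgroup H : Prop := group_closed [in H].

Lemma subgroupP H :
  subgroup H <-> [/\ H 1, forall x y, H x -> H y -> H (x * y)
                   & forall x, H x -> H x^-1].
Proof.
split=> [[H1 HF]|[H1 HM HV]].
  have Hone : H 1 by move: H1; rewrite inE.
  have Hinv x : H x -> H x^-1.
    by move=> Hx; have := HF 1 x; rewrite !inE div1g; apply.
  split=> // x y Hx Hy.
  by have := HF x y^-1; rewrite !inE invgK; apply=> //; apply: Hinv.
by split=> [|x y]; rewrite !inE // => Hx Hy; apply: HM => //; apply: HV.
Qed.

Definition generated A : set gT := smallest subgroup A.

Definition commg_subgroup A B : set gT :=
  generated [set [~ x, y] | x in A & y in B].

(* Indexed from 1: [lower_central 1 G] is [G] (as is the junk index 0), and
   [lower_central i.+1 G] is the commutator of [lower_central i G] and [G]. *)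
Definition lower_central (i : nat) G : set gT :=
  iter i.-1 (fun H => commg_subgroup H G) G.

Definition periodic G : Prop :=
  forall g, G g -> exists2 k : nat, (0 < k)%N & g ^+ k = 1.

Definition rcosets_of K G : set (set gT) :=
  [set [set k * g | k in K] | g in G].

Definition finite_index G K : Prop := finite_set (rcosets_of K G).

End Subgroups.

Section Tree.
Variable X : finType.
Implicit Types (u v w z : seq X) (x y : X).

Definition tree_edge u v : Prop :=
  (exists x, v = rcons u x) \/ (exists x, u = rcons v x).

Definition is_tree_aut (f : seq X -> seq X) : Prop :=
  [/\ bijective f, f [::] = [::]
    & forall u v, tree_edge u v <-> tree_edge (f u) (f v)].

Record tree_aut := TreeAut {
  tree_fun :> seq X -> seq X;
  tree_autP : is_tree_aut tree_fun }.

HB.instance Definition _ := gen_eqMixin tree_aut.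
HB.instance Definition _ := gen_choiceMixin tree_aut.

Lemma tree_autext (f g : tree_aut) : f =1 g -> f = g.
Proof.
case: f g => [f pf] [g pg] /= /funext efg.
by subst g; congr TreeAut; apply: Prop_irrelevance.
Qed.

Lemma tree_aut_inj (f : tree_aut) : injective f.
Proof. by case: (tree_autP f) => /bij_inj. Qed.

Lemma tree_aut_nil (f : tree_aut) : f [::] = [::].
Proof. by case: (tree_autP f). Qed.

Definition child_preserving (f : seq X -> seq X) :=
  forall u x, exists y, f (rcons u x) = rcons (f u) y.

Lemma tree_aut_rcons (f : tree_aut) : child_preserving f.
Proof.
have [_ f0 fE] := tree_autP f.
have edge u x : tree_edge (f u) (f (rcons u x)).
  by rewrite -fE; left; exists x.
elim/last_ind=> [|u x' IHu] x.
  case: (edge [::] x) => [[y ->]|[y]]; first by exists y.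
  by rewrite f0 => /(congr1 size); rewrite size_rcons.
case: (edge (rcons u x') x) => [[y ->]|[y]]; first by exists y.
have [y' ->] := IHu x' => /rcons_inj [/tree_aut_inj /(congr1 size)].
by rewrite !size_rcons => /eqP; rewrite -[X in X == _]addn0 -addn2 eqn_add2l.
Qed.

Lemma child_preserving_tree_aut (f g : seq X -> seq X) :
  cancel f g -> cancel g f -> f [::] = [::] ->
  child_preserving f -> child_preserving g -> is_tree_aut f.
Proof.
move=> fK gK f0 cf cg; split=> //; first by exists g.
have edge h : child_preserving h ->
    forall u v, tree_edge u v -> tree_edge (h u) (h v).
  move=> ch u v [] [x ->].
    by have [y ->] := ch u x; left; exists y.
  by have [y ->] := ch v x; right; exists y.
move=> u v; split=> [|fuv]; first exact: edge.
by rewrite -(fK u) -(fK v); apply: edge.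
Qed.

Lemma tree_aut_inv_exists (f : tree_aut) :
  exists g : tree_aut, cancel f g /\ cancel g f.
Proof.
have [[g fK gK] f0 fE] := tree_autP f.
suff g_aut : is_tree_aut g by exists (TreeAut g_aut).
split; first by exists f.
  by rewrite -f0 fK.
by move=> u v; rewrite (fE (g u)) !gK.
Qed.

Definition tree_inv (f : tree_aut) : tree_aut :=
  projT1 (cid (tree_aut_inv_exists f)).

Lemma tree_invK (f : tree_aut) : cancel f (tree_inv f).
Proof. by rewrite /tree_inv; case: cid => g []. Qed.

Lemma tree_invKV (f : tree_aut) : cancel (tree_inv f) f.
Proof. by rewrite /tree_inv; case: cid => g []. Qed.

Lemma tree_one_subproof : is_tree_aut id.
Proof. by split=> //; exists id. Qed.

Definition tree_one : tree_aut := TreeAut tree_one_subproof.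

(* Products are composed left to right. *)
Lemma tree_mul_subproof (f g : tree_aut) : is_tree_aut (fun u => g (f u)).
Proof.
have [bf f0 fE] := tree_autP f; have [bg g0 gE] := tree_autP g.
split; first exact: bij_comp bg bf.
  by rewrite f0.
by move=> u v; rewrite fE gE.
Qed.

Definition tree_mul (f g : tree_aut) : tree_aut :=
  TreeAut (tree_mul_subproof f g).

Lemma tree_mulA : associative tree_mul.
Proof. by move=> f g h; apply: tree_autext. Qed.

Lemma tree_mul1 : left_id tree_one tree_mul.
Proof. by move=> f; apply: tree_autext. Qed.

Lemma tree_mulr1 : right_id tree_one tree_mul.
Proof. by move=> f; apply: tree_autext. Qed.

Lemma tree_mulV : left_inverse tree_one tree_inv tree_mul.
Proof. by move=> f; apply: tree_autext => u; apply: tree_invKV. Qed.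

Lemma tree_mulrV : right_inverse tree_one tree_inv tree_mul.
Proof. by move=> f; apply: tree_autext => u; apply: tree_invK. Qed.

HB.instance Definition _ :=
  isGroup.Build tree_aut tree_mulA tree_mul1 tree_mulr1 tree_mulV tree_mulrV.

Lemma tree_aut1E u : (1 : tree_aut) u = u.
Proof. by []. Qed.

Lemma tree_autME (f g : tree_aut) u : (f * g) u = g (f u).
Proof. by []. Qed.

Lemma tree_autK (f : tree_aut) : cancel f (f^-1)%g.
Proof. exact: tree_invK. Qed.

Lemma tree_autVK (f : tree_aut) : cancel (f^-1)%g f.
Proof. exact: tree_invKV. Qed.

Lemma size_tree_aut (f : tree_aut) u : size (f u) = size u.
Proof.
elim/last_ind: u => [|u x IHu]; first by rewrite tree_aut_nil.
by have [y ->] := tree_aut_rcons f u x; rewrite !size_rcons IHu.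
Qed.

Definition section_fun (f : tree_aut) u z : seq X := drop (size u) (f (u ++ z)).

Lemma section_funE (f : tree_aut) u z : f (u ++ z) = f u ++ section_fun f u z.
Proof.
rewrite -[LHS](cat_take_drop (size u)); congr (_ ++ _).
elim/last_ind: z => [|z x IHz].
  by rewrite cats0 -(size_tree_aut f) take_size.
rewrite -rcons_cat; have [y ->] := tree_aut_rcons f (u ++ z) x.
by rewrite -cats1 takel_cat ?IHz ?size_tree_aut ?size_cat ?leq_addr.
Qed.

Lemma section_subproof (f : tree_aut) u : is_tree_aut (section_fun f u).
Proof.
have sK (g h : tree_aut) v :
    cancel g h -> cancel (section_fun g v) (section_fun h (g v)).
  move=> gK z; rewrite {1}/section_fun -section_funE gK size_tree_aut.
  exact: drop_size_cat.
have cs (g : tree_aut) v : child_preserving (section_fun g v).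
  move=> z x; rewrite /section_fun -rcons_cat.
  have [y ->] := tree_aut_rcons g (v ++ z) x; exists y.
  by rewrite drop_rcons // size_tree_aut size_cat leq_addr.
apply: (@child_preserving_tree_aut _ (section_fun (f^-1)%g (f u))) => //.
- exact/sK/tree_autK.
- by have := sK _ _ (f u) (@tree_autVK f); rewrite tree_autK.
- by rewrite /section_fun cats0 -(size_tree_aut f) drop_size.
Qed.

Definition section (f : tree_aut) u : tree_aut := TreeAut (section_subproof f u).

Lemma sectionE (f : tree_aut) u z : f (u ++ z) = f u ++ section f u z.
Proof. exact: section_funE. Qed.

Definition st1 : set tree_aut := [set f : tree_aut | forall x, f [:: x] = [:: x]].

(* The map called psi is only used on [st1]. *)
Definition psi (f : tree_aut) : {ffun X -> tree_aut} :=
  [ffun x => section f [:: x]].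

Definition level_transitive (G : set tree_aut) : Prop :=
  forall (l : nat) u v, size u = l -> size v = l -> exists2 g, G g & g u = v.

Definition self_similar (G : set tree_aut) : Prop :=
  forall g u, G g -> G (section g u).

Definition regular_branch_over (G K : set tree_aut) : Prop :=
  [/\ level_transitive G, self_similar G,
      [/\ subgroup K, K <> [set 1] & K `<=` st1 `&` G],
      [set k : {ffun X -> tree_aut} | forall x, K (k x)] `<=` psi @` K
    & finite_index G K].

End Tree.

Section GGS.
Variable m : nat.
Implicit Types (u z : seq 'I_m) (x : 'I_m).

Definition shift_head (s : 'I_m -> 'I_m) u : seq 'I_m :=
  if u is x :: z then s x :: z else [::].

Lemma GGS_a_subproof : is_tree_aut (shift_head (@ordS m)).
Proof.
have cs s : child_preserving (shift_head s) by case=> [|y u] x /=; eexists.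
by apply: (@child_preserving_tree_aut _ _ (shift_head (@ord_pred m))) => // -[|x z] //=;
  rewrite ?ordSK ?ord_predK.
Qed.

Definition GGS_a : tree_aut 'I_m := TreeAut GGS_a_subproof.

Variable e : 'rV['Z_m]_m.-1.

(* The letters x_1, ..., x_m are the ordinals 0, ..., m - 1, so that the section
   of b at the ordinal i is a ^ (e 0 i) when i < m - 1, and b when i = m - 1,
   which is the only i : 'I_m with [insub i = None :> option 'I_m.-1]. *)
Fixpoint GGS_b_fun u : seq 'I_m :=
  if u is x :: z then
    x :: (if insub (val x) is Some i then (GGS_a ^+ (e ord0 i)) z else GGS_b_fun z)
  else [::].

Fixpoint GGS_bV_fun u : seq 'I_m :=
  if u is x :: z then
    x :: (if insub (val x) is Some i then (GGS_a ^- (e ord0 i)) z else GGS_bV_fun z)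
  else [::].

Lemma GGS_b_subproof : is_tree_aut GGS_b_fun.
Proof.
apply: (@child_preserving_tree_aut _ _ GGS_bV_fun) => //.
- elim=> //= x z IHz; case: insub => [i|]; last by rewrite IHz.
  by rewrite tree_autK.
- elim=> //= x z IHz; case: insub => [i|]; last by rewrite IHz.
  by rewrite tree_autVK.
- elim=> [|y u IHu] x /=; first by case: insub => [i|]; rewrite ?tree_aut_nil; exists x.
  case: insub => [i|]; last by have [t ->] := IHu x; exists t.
  by have [t ->] := tree_aut_rcons (GGS_a ^+ (e ord0 i)) u x; exists t.
- elim=> [|y u IHu] x /=; first by case: insub => [i|]; rewrite ?tree_aut_nil; exists x.
  case: insub => [i|]; last by have [t ->] := IHu x; exists t.
  by have [t ->] := tree_aut_rcons (GGS_a ^- (e ord0 i)) u x; exists t.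
Qed.

Definition GGS_b : tree_aut 'I_m := TreeAut GGS_b_subproof.

Lemma GGS_b_st1 : st1 GGS_b.
Proof. by move=> x /=; case: insub => [i|]; rewrite ?tree_aut_nil. Qed.

Lemma psi_GGS_b :
  psi GGS_b = [ffun x : 'I_m =>
    if insub (val x) is Some i then GGS_a ^+ (e ord0 i) else GGS_b].
Proof.
apply/ffunP => x; rewrite !ffunE; apply: tree_autext => z /=.
by rewrite /section_fun /= drop0; case: insub.
Qed.

Definition GGS_group : set (tree_aut 'I_m) := generated [set GGS_a; GGS_b].

End GGS.

(* (Z/p^n)^(p^n-1) minus (pZ/p^n)^(p^n-1). *)
Definition defvec_F (p n : nat) : set 'rV['Z_(p ^ n)]_(p ^ n).-1 :=
  ~` [set e | forall i, exists c : 'Z_(p ^ n), e ord0 i = (p%:R * c)%R].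

Arguments defvec_F : clear implicits.

(* Main.v *)
From HB Require Import structures.
Require Import Defs.
From mathcomp Require Import all_boot all_algebra finfield zify.
From mathcomp Require Import boolp classical_sets functions cardinality.

(** Write [m = p^n], [K = gamma_3(G)], [G'] for the derived subgroup, and index
    letters by [Z/m].  Let [b_s] be the conjugate of [b] by a power of [a] whose
    section at the letter [s] is [b] ([conj_b]); its section at another letter [x] is a
    power of [a], with exponent [eps (x - s)].

    All [b_s] agree modulo [G'], so [[b_s, b_t]] lies in [K] ([conj_bR_gamma3]);
    and it is trivial except at the letters [s] and [t].  Fix [D] such that
    [eps D] is a unit, and call [x] and [y] linked if the automorphism with
    sections [x] at [0] and [y^-1] at [-D] lies in [K].  From [[b_0, b_(-D)]]
    and conjugation, every [x] in [G'] is linked to some [y] in [G']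
    ([linked_total]).  Conjugating by products of the other [b_s] turns a link
    between [x] and [y] into one between [x^(a^alpha)] and [y^(a^beta)], for
    pairs [(alpha, beta)] read off from [eps].  If [beta] is a unit and
    [lambda = alpha / beta], a chain of [m] links starting at [x] returns to the
    letter [0], and telescopes to an element of [K] concentrated there.  The
    chains of [x] and of its conjugates differ by a twist by [lambda^m], and
    comparing them puts the copy of [[x, a^(lambda^m - 1)]] at one letter into
    [K].  As [lambda^m = lambda] modulo [p], the exponent is a unit as soon as
    [alpha] and [beta] are distinct modulo [p], and then [[x, a]] has its copy
    in [K] for every [x] in [G'] ([derived_commutes_a]).  Commuting
    [[b_0, b_(-D)]] with [b_0] gives the same for [[b, a^(eps D), b]], so that
    all of [K] has its copies in [K] ([gamma3_sub_branch_part]).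

    It remains to find [D] and a pair with [alpha] and [beta] distinct modulo
    [p].  If there is none, then [eps] is periodic modulo [p] away from [0], so
    its sum is not zero modulo [p] ([exists_separating_pair]).  But in that case
    [a b] has infinite order: for a unit [u], a suitable section of [(a^u b)^m]
    is [a^S b], where [S] is the sum of the defining vector ([apow_b_infinite_order]). *)

Set Implicit Arguments.
Unset Strict Implicit.
Unset Printing Implicit Defensive.

Import GRing.Theory.

(** * Commutators and the lower central series *)

Section GroupTheory.
Local Open Scope classical_set_scope.
Local Open Scope group_scope.
Variable gT : groupType.
Implicit Types (A G H K N L : set gT) (x y g h : gT).

Section SubgroupOps.
Variable H : set gT.
Hypothesis sH : subgroup H.

Lemma subgroup1 : H 1. Proof. by case/subgroupP: sH. Qed.

Lemma subgroupM x y : H x -> H y -> H (x * y).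
Proof. by case/subgroupP: sH => _ + _; apply. Qed.

Lemma subgroupV x : H x -> H x^-1.
Proof. by case/subgroupP: sH => _ _; apply. Qed.

Lemma subgroupX x i : H x -> H (x ^+ i).
Proof.
move=> Hx; elim: i => [|i IHi]; first exact: subgroup1.
by rewrite expgS; apply: subgroupM.
Qed.

Lemma subgroupJ x y : H x -> H y -> H (x ^ y).
Proof. by move=> Hx Hy; do !apply: subgroupM => //; apply: subgroupV. Qed.

Lemma subgroupR x y : H x -> H y -> H [~ x, y].
Proof. by move=> Hx Hy; apply: subgroupM; [apply: subgroupV|apply: subgroupJ]. Qed.

End SubgroupOps.

Lemma generated_subgroup A : subgroup (generated A).
Proof.
apply/subgroupP; split=> [|x y Ax Ay|x Ax] H [sH AH].
- exact: subgroup1.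
- by apply: subgroupM => //; [apply: Ax|apply: Ay].
- by apply: subgroupV => //; apply: Ax.
Qed.

Lemma mem_generated A x : A x -> generated A x.
Proof. by move=> Ax H [_]; apply. Qed.

Lemma generated_min A H : subgroup H -> A `<=` H -> generated A `<=` H.
Proof. by move=> sH AH x; apply. Qed.

(** [N] is not required to lie in [G], so that the stabiliser of the first level
    and the subgroups defined through sections qualify. *)
Definition normalised_by G N : Prop :=
  subgroup N /\ forall x g, N x -> G g -> N (x ^ g).

Section Commutators.
Variables (G : set gT) (N : set gT).
Hypotheses (sG : subgroup G) (nN : normalised_by G N).

Let sN : subgroup N := proj1 nN.
Let NJ : forall x g, N x -> G g -> N (x ^ g) := proj2 nN.

(** Centralisers modulo a normal subgroup are subgroups, because of
    [[x, gh] = [x, h] [x, g]^h] and its consequence for inverses. *)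
Lemma centraliser_mod_subgroup x : subgroup [set g | G g /\ N [~ x, g]].
Proof.
apply/subgroupP; split=> [|g h [Gg Ng] [Gh Nh]|g [Gg Ng]].
- by split; [exact: subgroup1|rewrite commg1; exact: subgroup1].
- split; first exact: subgroupM.
  suff -> : [~ x, g * h] = [~ x, h] * [~ x, g] ^ h.
    by apply: subgroupM => //; apply: NJ.
  by rewrite /commg /conjg !gnorm.
- split; first exact: subgroupV.
  suff -> : [~ x, g^-1] = ([~ x, g] ^ g^-1)^-1.
    by apply: subgroupV => //; apply: NJ => //; apply: subgroupV.
  by rewrite /commg /conjg !gnorm.
Qed.

Lemma commutatorC x y : N [~ x, y] -> N [~ y, x].
Proof. by move=> Nxy; rewrite -invgR; apply: subgroupV. Qed.

Definition centre_mod : set gT := [set g | G g /\ forall h, G h -> N [~ g, h]].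

Lemma centre_mod_normalised : normalised_by G centre_mod.
Proof.
split.
  apply/subgroupP; split=> [|x y [Gx Cx] [Gy Cy]|x [Gx Cx]].
  - by split=> [|h _]; rewrite ?comm1g; apply: subgroup1.
  - split=> [|h Gh]; first exact: subgroupM.
    apply: commutatorC.
    by have [] := subgroupM (centraliser_mod_subgroup h)
      (conj Gx (commutatorC (Cx h Gh))) (conj Gy (commutatorC (Cy h Gh))).
  - split=> [|h Gh]; first exact: subgroupV.
    apply: commutatorC.
    by have [] := subgroupV (centraliser_mod_subgroup h)
      (conj Gx (commutatorC (Cx h Gh))).
move=> x g [Gx Cx] Gg; split=> [|h Gh]; first exact: subgroupJ.
rewrite -[h](conjgKV g) -conjRg; apply: NJ => //; apply: Cx.
by apply: subgroupJ => //; apply: subgroupV.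
Qed.

End Commutators.

Lemma centraliser_mod_generated A N x :
    normalised_by (generated A) N -> (forall y, A y -> N [~ x, y]) ->
  forall g, generated A g -> N [~ x, g].
Proof.
move=> nN NA g; have sG := generated_subgroup A.
suff: generated A `<=` [set g | generated A g /\ N [~ x, g]] by move=> /[apply] -[].
apply: generated_min; first exact: centraliser_mod_subgroup.
by move=> y Ay; split; [apply: mem_generated|apply: NA].
Qed.

(** Centralisers modulo [N] extend the hypothesis from generators to all of the
    group, in one variable at a time. *)
Lemma derived_subset A N :
    normalised_by (generated A) N -> (forall x y, A x -> A y -> N [~ x, y]) ->
  commg_subgroup (generated A) (generated A) `<=` N.
Proof.
move=> nN NA; apply: generated_min; first by case: nN.
move=> _ [g Gg [h Gh <-]].
apply: (centraliser_mod_generated nN) => // y Ay.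
apply: (commutatorC nN); apply: (centraliser_mod_generated nN) => // x Ax.
exact: NA.
Qed.

Lemma commg_subgroup_normalised G H : subgroup G ->
  (forall x g, H x -> G g -> H (x ^ g)) -> normalised_by G (commg_subgroup H G).
Proof.
move=> sG HJ; have sN := generated_subgroup [set [~ x, y] | x in H & y in G].
split=> // x g Hx Gg.
suff: commg_subgroup H G `<=` [set x | commg_subgroup H G (x ^ g)] by apply.
apply: generated_min.
  apply/subgroupP; split=> [|y z|y] /=; rewrite ?conj1g ?conjMg ?conjVg.
  - exact: subgroup1.
  - exact: subgroupM.
  - exact: subgroupV.
move=> _ [y Hy [z Gz <-]] /=; rewrite conjRg; apply: mem_generated.
by exists (y ^ g); [apply: HJ|exists (z ^ g) => //; apply: subgroupJ].
Qed.

Lemma derived_normalised G : subgroup G -> normalised_by G (commg_subgroup G G).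
Proof. by move=> sG; apply: commg_subgroup_normalised => // x g; apply: subgroupJ. Qed.

Lemma gamma3_normalised G : subgroup G -> normalised_by G (lower_central 3 G).
Proof.
move=> sG; apply: commg_subgroup_normalised => //.
exact: (derived_normalised sG).2.
Qed.

Lemma derivedR G x y : G x -> G y -> commg_subgroup G G [~ x, y].
Proof. by move=> Gx Gy; apply: mem_generated; exists x => //; exists y. Qed.

Lemma derived_sub G : subgroup G -> commg_subgroup G G `<=` G.
Proof. by move=> sG; apply: generated_min => // _ [x Gx [y Gy <-]]; apply: subgroupR. Qed.

Lemma gamma3R G x y : commg_subgroup G G x -> G y -> lower_central 3 G [~ x, y].
Proof. by move=> Gx Gy; apply: mem_generated; exists x => //; exists y. Qed.

Lemma gamma3_sub_derived G : subgroup G -> lower_central 3 G `<=` commg_subgroup G G.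
Proof.
move=> sG; apply: generated_min; first exact: generated_subgroup.
by move=> _ [x /(derived_sub sG) Gx [y Gy <-]]; apply: derivedR.
Qed.

Lemma commgMl_self x y : [~ x, x * y] = [~ x, y].
Proof. by rewrite /commg /conjg !gnorm. Qed.

Lemma expg_modn x o i : x ^+ o = 1 -> x ^+ (i %% o) = x ^+ i.
Proof.
by move=> xo; rewrite {2}(divn_eq i o) expgnDr mulnC expgnA xo expg1n mul1g.
Qed.

Section ClassTwo.
Variables a b : gT.
Let G := generated [set a; b].
Let G' := commg_subgroup G G.
Let K := lower_central 3 G.
Let c := [~ b, a].
Hypothesis perG : periodic G.

Let sG : subgroup G := generated_subgroup _.
Let Ga : G a. Proof. by apply: mem_generated; left. Qed.
Let Gb : G b. Proof. by apply: mem_generated; right. Qed.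
Let G'c : G' c. Proof. exact: derivedR. Qed.
Let Gc : G c. Proof. exact: (subgroupR sG). Qed.
Let sK : subgroup K := (gamma3_normalised sG).1.
Let KJ x g : K x -> G g -> K (x ^ g). Proof. exact: (gamma3_normalised sG).2. Qed.

Let KcX : set gT := [set k * c ^+ l | k in K & l in [set: nat]].

(** Closed under inverses because [c] has finite order, and under conjugation
    because [c] is central modulo [K]. *)
Let KcX_normalised : normalised_by G KcX.
Proof.
have [oc oc_gt0 c_oc] := perG Gc.
have KJVK k l : K k -> K (k ^ (c ^+ l)^-1).
  by move=> Kk; apply: KJ => //; apply: (subgroupV sG); apply: (subgroupX sG).
split.
  apply/subgroupP; split=> [|_ _ [k Kk [l _ <-]] [k' Kk' [l' _ <-]]|_ [k Kk [l _ <-]]].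
  - by exists 1; [apply: (subgroup1 sK)|exists 0%N; rewrite // mul1g].
  - exists (k * k' ^ (c ^+ l)^-1); first by apply: (subgroupM sK) => //; apply: KJVK.
    by exists (l + l')%N; rewrite // expgnDr /conjg !gnorm.
  - exists (k^-1 ^ c ^+ l).
      by apply: KJ; [apply: (subgroupV sK)|apply: (subgroupX sG)].
    exists (oc.-1 * l)%N => //.
    have -> : c ^+ (oc.-1 * l) = (c ^+ l)^-1.
      rewrite mulnC expgnA; apply/eqP; rewrite -mulg_eq1 -expgSr prednK //.
      by rewrite -expgnA mulnC expgnA c_oc expg1n.
    by rewrite /conjg !gnorm.
move=> _ g [k Kk [l _ <-]] Gg.
have Kr : K [~ c ^+ l, g].
  by apply: gamma3R => //; apply: (subgroupX (generated_subgroup _)).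
exists (k ^ g * [~ c ^+ l, g] ^ (c ^+ l)^-1).
  by apply: (subgroupM sK); [apply: KJ|apply: KJVK].
exists l => //; rewrite conjMg -mulgA; congr (_ * _).
by rewrite -conjgCV /commg mulVKg.
Qed.

(** Modulo [gamma_3], the derived subgroup is generated by the single
    commutator [c], so every element is [c^l b^j a^i] up to a factor of [K]. *)
Lemma gamma3_finite_index : finite_index G K.
Proof.
have [oa oa_gt0 a_oa] := perG Ga; have [ob ob_gt0 b_ob] := perG Gb.
have [oc oc_gt0 c_oc] := perG Gc.
have sN : subgroup KcX := KcX_normalised.1.
have G'N : G' `<=` KcX.
  have N1 : KcX 1 by apply: (subgroup1 sN).
  have Nc : KcX c by exists 1; [apply: (subgroup1 sK)|exists 1%N; rewrite // mul1g].
  apply: derived_subset KcX_normalised _ => _ _ [->|->] [->|->]; rewrite ?commgg //.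
  by rewrite -invgR; apply: (subgroupV sN).
pose P x := exists y j i, KcX y /\ x = y * b ^+ j * a ^+ i.
have Pa x : P x -> P (x * a).
  by move=> [y [j [i [Ny ->]]]]; exists y, j, i.+1; rewrite expgSr mulgA.
have Pb x : P x -> P (x * b).
  move=> [y [j [i [Ny ->]]]].
  exists (y * [~ (a ^+ i)^-1, b^-1] ^ (b ^+ j)^-1), j.+1, i; split.
    apply: (subgroupM sN) => //; apply: G'N; apply: (derived_normalised sG).2.
      by apply: derivedR; apply: (subgroupV sG) => //; apply: (subgroupX sG).
    by apply: (subgroupV sG); apply: (subgroupX sG).
  by rewrite -!mulgA [a ^+ i * b]commgCV expgSr /conjg !gnorm.
pose S := [set g | G g /\ forall x, P x -> P (x * g)].
have SX g i : S g -> S (g ^+ i).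
  move=> [Gg Sg]; elim: i => [|i [Gi IHi]].
    by split=> [|x]; [exact: (subgroup1 sG)|rewrite mulg1].
  by rewrite expgS; split=> [|x Px]; [exact: (subgroupM sG)|rewrite mulgA; apply/IHi/Sg].
have GS : G `<=` S.
  apply: generated_min => [|_ [->|->]] //.
  apply/subgroupP; split=> [|g h [Gg Sg] [Gh Sh]|g Sg].
  - by split=> [|x]; [exact: (subgroup1 sG)|rewrite mulg1].
  - by split=> [|x Px]; [exact: (subgroupM sG)|rewrite mulgA; apply/Sh/Sg].
  - have [k k_gt0 gk] := perG Sg.1.
    suff -> : g^-1 = g ^+ k.-1 by apply: SX.
    by apply/eqP; rewrite eq_sym -mulg_eq1 -expgSr prednK // gk.
pose F (t : 'I_oc * 'I_ob * 'I_oa) :=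
  [set k * (c ^+ t.1.1 * b ^+ t.1.2 * a ^+ t.2) | k in K].
apply: (@sub_finite_set _ _ (F @` setT)); last exact/finite_image/finite_finset.
move=> _ [g Gg <-].
have [_ [j [i [[k Kk [l _ <-]]]]]] : P g.
  rewrite -[g]mul1g; apply: (GS g Gg).2.
  by exists 1, 0%N, 0%N; rewrite !mulg1; split=> //; apply: (subgroup1 sN).
rewrite -(expg_modn i a_oa) -(expg_modn j b_ob) -(expg_modn l c_oc) => ->.
exists (Ordinal (ltn_pmod l oc_gt0), Ordinal (ltn_pmod j ob_gt0),
        Ordinal (ltn_pmod i oa_gt0)) => //.
rewrite /F /=; apply/seteqP; split=> _ [k' Kk' <-].
  exists (k' * k^-1); first by apply: (subgroupM sK) => //; apply: (subgroupV sK).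
  by rewrite !mulgA mulgVK.
by exists (k' * k); [apply: (subgroupM sK)|rewrite !mulgA].
Qed.

End ClassTwo.
End GroupTheory.

(** * Sections and copies of automorphisms below a letter *)

Section Sections.
Local Open Scope classical_set_scope.
Local Open Scope group_scope.
Variable X : finType.
Implicit Types (f g h : tree_aut X) (u v z : seq X) (x y : X).

Definition letter f x : X := head x (f [:: x]).

Lemma tree_aut_letter f x : f [:: x] = [:: letter f x].
Proof. by rewrite /letter; have := size_tree_aut f [:: x]; case: (f [:: x]) => [|y []]. Qed.

Lemma tree_aut_cons f x z : f (x :: z) = letter f x :: section f [:: x] z.
Proof. by rewrite -[x :: z]/([:: x] ++ z) sectionE tree_aut_letter. Qed.

Lemma letterM f g x : letter (f * g) x = letter g (letter f x).
Proof. by rewrite {1}/letter tree_autME !tree_aut_letter. Qed.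

Lemma letterV f x : letter f^-1 (letter f x) = x.
Proof. by rewrite -letterM mulgV. Qed.

Lemma letterVK f x : letter f (letter f^-1 x) = x.
Proof. by rewrite -letterM mulVg. Qed.

Lemma letter_st1 f x : st1 f -> letter f x = x.
Proof. by rewrite /letter => ->. Qed.

Lemma st1_letter f : (forall x, letter f x = x) -> st1 f.
Proof. by move=> fx x; rewrite tree_aut_letter fx. Qed.

Lemma section_eq f u g : (forall z, f (u ++ z) = f u ++ g z) -> section f u = g.
Proof.
move=> fg; apply: tree_autext => z; have := fg z; rewrite sectionE => /eqP.
by rewrite eqseq_cat // => /andP[_ /eqP].
Qed.

Lemma section1 u : section 1 u = 1.
Proof. exact: section_eq. Qed.

Lemma sectionM f g u : section (f * g) u = section f u * section g (f u).
Proof. by apply: section_eq => z; rewrite !tree_autME !sectionE. Qed.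

Lemma sectionV f u : section f^-1 (f u) = (section f u)^-1.
Proof.
by apply/eqP; rewrite -mulg_eq1 -{2}(tree_autK f u) -sectionM mulVg section1.
Qed.

Lemma section_cat f u v : section f (u ++ v) = section (section f u) v.
Proof. by apply: section_eq => z; rewrite -catA !sectionE catA. Qed.

Lemma sectionX_fix f u i : f u = u -> section (f ^+ i) u = section f u ^+ i.
Proof.
move=> fu; elim: i => [|i IHi]; first exact: section1.
by rewrite !expgS sectionM fu IHi.
Qed.

Lemma st1_subgroup : subgroup (@st1 X).
Proof.
apply/subgroupP; split=> [x|f g sf sg x|f sf x] //; first by rewrite tree_autME sf sg.
by rewrite -{1}(sf x) tree_autK.
Qed.

Lemma st1_ext f g : st1 f -> st1 g ->
  (forall x, section f [:: x] = section g [:: x]) -> f = g.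
Proof.
move=> sf sg fg; apply: tree_autext => -[|x z]; first by rewrite !tree_aut_nil.
by rewrite !tree_aut_cons fg !letter_st1.
Qed.

Lemma section_st1M f g x : st1 f ->
  section (f * g) [:: x] = section f [:: x] * section g [:: x].
Proof. by move=> sf; rewrite sectionM sf. Qed.

Lemma section_st1V f x : st1 f -> section f^-1 [:: x] = (section f [:: x])^-1.
Proof. by move=> sf; rewrite -{1}(sf x) sectionV. Qed.

Lemma section_st1R f g x : st1 f -> st1 g ->
  section [~ f, g] [:: x] = [~ section f [:: x], section g [:: x]].
Proof.
move=> sf sg; have sV := subgroupV st1_subgroup.
by rewrite !section_st1M ?section_st1V //; apply: sV.
Qed.

Definition tree_at_fun x (g : tree_aut X) u : seq X :=
  if u is y :: z then y :: (if y == x then g z else z) else [::].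

Lemma tree_at_subproof x g : is_tree_aut (tree_at_fun x g).
Proof.
have K (h h' : tree_aut X) : cancel h h' -> cancel (tree_at_fun x h) (tree_at_fun x h').
  by move=> hK [|y z] //=; case: eqP => //= _; rewrite hK.
have cp h : child_preserving (tree_at_fun x h).
  move=> [|y u] t /=; first by exists t; rewrite tree_aut_nil if_same.
  by case: eqP => _; [have [s ->] := tree_aut_rcons h u t; exists s|exists t].
apply: (@child_preserving_tree_aut _ _ (tree_at_fun x g^-1)) => //.
  exact/K/tree_autK.
exact/K/tree_autVK.
Qed.

(** The preimage under [psi] of the tuple with [g] at [x] and [1] elsewhere.  As
    an automorphism it can also be conjugated by elements outside [st1]. *)
Definition tree_at x g : tree_aut X := TreeAut (tree_at_subproof x g).

Lemma tree_at_st1 x g : st1 (tree_at x g).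
Proof. by move=> y /=; rewrite tree_aut_nil if_same. Qed.
Hint Resolve tree_at_st1 : core.

Lemma section_tree_at x g y : section (tree_at x g) [:: y] = if y == x then g else 1.
Proof. by apply: section_eq => z /=; rewrite tree_aut_nil if_same; case: eqP. Qed.

Lemma tree_atM x g h : tree_at x (g * h) = tree_at x g * tree_at x h.
Proof. by apply: tree_autext => -[|y z] //=; case: eqP. Qed.

Lemma tree_at1 x : tree_at x 1 = 1.
Proof. by apply: tree_autext => -[|y z] //=; rewrite if_same. Qed.

Lemma tree_atV x g : tree_at x g^-1 = (tree_at x g)^-1.
Proof. by apply/eqP; rewrite -mulg_eq1 -tree_atM mulVg tree_at1. Qed.

Lemma tree_at_commute x y g h : x != y -> commute (tree_at x g) (tree_at y h).
Proof.
move=> xy; apply: tree_autext => -[|t z] //=.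
by case: (t =P x) => [->|//]; rewrite (negPf xy).
Qed.

Lemma tree_atJ x g h : tree_at x g ^ h = tree_at (letter h x) (g ^ section h [:: x]).
Proof.
suff: tree_at x g * h = h * tree_at (letter h x) (g ^ section h [:: x]).
  by rewrite /conjg => ->; rewrite mulKg.
apply: tree_autext => -[|y z] //; first by rewrite !tree_aut_nil.
rewrite !tree_autME (tree_aut_cons h y z) /= tree_aut_cons.
rewrite (inj_eq (can_inj (letterV h))); case: eqP => [->|//].
by congr (_ :: section _ _ (g _)); rewrite (tree_autK (section h [:: x])).

Qed.

Lemma tree_at_pairR x y f g h : x != y -> st1 h ->
  [~ tree_at x f * tree_at y g, h] =
    tree_at x [~ f, section h [:: x]] * tree_at y [~ g, section h [:: y]].
Proof.
move=> xy sh; have sM f1 g1 : st1 (tree_at x f1 * tree_at y g1).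
  by apply: (subgroupM st1_subgroup).
apply: st1_ext => // [|t]; first exact: (subgroupR st1_subgroup).
rewrite section_st1R // !(section_st1M _ _ (tree_at_st1 _ _)) !section_tree_at.
have [->|tx] := eqVneq t x; first by rewrite (negPf xy) !mulg1.
by have [->|ty] := eqVneq t y; rewrite !mul1g ?comm1g.
Qed.

End Sections.

(** * Residues modulo p and sums over Z/p^n *)

Section ModP.
Local Open Scope classical_set_scope.
Local Open Scope group_scope.
Variables (p n k : nat).
Hypotheses (p_pr : prime p) (def_m : k.+2 = (p ^ n)%N).
Local Notation Z := 'I_k.+2.
Implicit Types (x y D j : Z).
Local Open Scope ring_scope.

Let n_gt0 : (0 < n)%N.
Proof. by move: def_m; case: n => //=; rewrite expn0. Qed.

Let p_dvd_m : (p %| k.+2)%N.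
Proof. by rewrite def_m dvdn_exp. Qed.

Definition residue x : 'F_p := (x : nat)%:R.

Lemma natr_mod_Fp i : (i %% k.+2)%:R = i%:R :> 'F_p.
Proof. by rewrite -(Fp_nat_mod p_pr (i %% _)) modn_dvdm // Fp_nat_mod. Qed.

Lemma residueD x y : residue (x + y) = residue x + residue y.
Proof. by rewrite /residue /= natr_mod_Fp natrD. Qed.

Lemma residueM x y : residue (x * y) = residue x * residue y.
Proof. by rewrite /residue /= natr_mod_Fp natrM. Qed.

Lemma residue0 : residue 0 = 0. Proof. by []. Qed.

Lemma residue1 : residue 1 = 1. Proof. by []. Qed.

Lemma residueB x y : residue (x - y) = residue x - residue y.
Proof. by apply/(addIr (residue y)); rewrite -residueD !subrK. Qed.

Lemma residueX x i : residue (x ^+ i) = residue x ^+ i.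
Proof. by elim: i => [|i IHi]; rewrite ?expr0 ?residue1 // !exprS residueM IHi. Qed.

Lemma residue_sum (P : pred Z) (F : Z -> Z) :
  residue (\sum_(j | P j) F j) = \sum_(j | P j) residue (F j).
Proof. exact: (big_morph _ residueD residue0). Qed.

Lemma residue_eq0 x : (residue x == 0) = (p %| x)%N.
Proof. by rewrite (dvdn_pcharf (pchar_Fp p_pr)). Qed.

Lemma residue_unit x : residue x != 0 -> x \is a GRing.unit.
Proof.
move=> rx; have := @unitZpE k.+2 x isT; rewrite natr_Zp => ->.
have -> : coprime k.+2 x = coprime (p ^ n) x by rewrite -def_m.
by rewrite coprimeXl // prime_coprime // -residue_eq0.
Qed.

Lemma residueXm x : residue (x ^+ k.+2) = residue x.
Proof.
rewrite residueX def_m; elim: n => [|i IHi]; first by rewrite expn0.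
by rewrite expnSr exprM IHi -[RHS](expf_card (residue x)) card_Fp.
Qed.

(** A function on [Z/p^n] with a non-zero period takes each value a multiple
    of [p] times.  The quotient [g] by the [p]-part of the period grows by a
    fixed unit [w] along it, so translating [sum f g] gives [w (sum f) = 0]. *)
Lemma sum_periodic (f : Z -> 'F_p) D :
  D != 0 -> (forall j, f (j + D) = f j) -> \sum_j f j = 0.
Proof.
move=> D0 fD; have D_gt0 : (0 < D)%N by rewrite lt0n; apply: contra D0 => /eqP D0; apply/eqP/val_inj.
set q := (p ^ logn p D)%N; pose g j : 'F_p := (j %/ q)%:R.
have q_gt0 : (0 < q)%N by rewrite expn_gt0 prime_gt0.
have /dvdnP[w Dw] : (q %| D)%N by rewrite pfactor_dvdnn.
have w0 : (w%:R : 'F_p) != 0.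
  rewrite -(dvdn_pcharf (pchar_Fp p_pr)); apply/negP => /dvdnP[t wt].
  have : (p ^ (logn p D).+1 %| D)%N by rewrite expnS [X in (_ %| X)%N]Dw wt -mulnA dvdn_mull.
  by rewrite pfactor_dvdn // ltnn.
have : (q * p %| p ^ n)%N.
  rewrite -expnSr dvdn_exp2l // ltnNge; apply/negP => le_n.
  have : (p ^ n %| D)%N by apply: (dvdn_trans _ (pfactor_dvdnn p D)); apply: dvdn_exp2l.
  by rewrite -def_m gtnNdvd.
rewrite -def_m => /dvdnP[t mt].
have gD j : g (j + D) = g j + w%:R.
  have -> : g j + w%:R = ((j + D) %/ q)%:R by rewrite Dw addnC divnMDl // natrD addrC.
  rewrite (divn_eq (j + D) k.+2) [in X in (_ * X)%N]mt [(q * p)%N]mulnC !mulnA.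
  by rewrite divnMDl // natrD natrM pchar_Fp_0 // mulr0 add0r.
have : \sum_j f j * g j = \sum_j f j * g j + w%:R * \sum_j f j.
  rewrite [LHS](reindex_inj (addIr D)) mulr_sumr -big_split /=.
  by apply: eq_bigr => j _; rewrite fD gD mulrDr [w%:R * _]mulrC.
move/eqP; rewrite -[X in X == _]addr0 (inj_eq (addrI _)) eq_sym mulf_eq0.
by rewrite (negPf w0) => /eqP.
Qed.

(** Once the value at [0] is replaced with [f D], the recurrence propagates
    along the multiples of [D] and makes [f] periodic, so the modified sum
    vanishes; the original one differs from it by [f D]. *)
Lemma sum_almost_periodic (f : Z -> 'F_p) D : D != 0 -> f D != 0 ->
  (forall j, j != 0 -> j != D -> f j = f (j - D)) -> \sum_(j | j != 0) f j != 0.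
Proof.
move=> D0 fD0 fD; have m0 : k.+2%:R = 0 :> Z := @pchar_Zp k.+2 isT.
pose F j := if j == 0 then f D else f j.
have F_orbit i : F (D *+ i.+1) = f D.
  elim: i => [|i IHi]; first by rewrite mulr1n /F (negPf D0).
  rewrite /F; case: eqVneq => // iD0.
  case: (eqVneq (D *+ i.+2) D) => [->//|iD].
  rewrite fD // mulrSr addrK -[RHS]IHi /F; case: eqVneq => // iD0'.
  by rewrite mulrSr iD0' add0r eqxx in iD.
have FD j : F (j + D) = F j.
  have [->|j0] := eqVneq j 0; first by rewrite add0r /F eqxx (negPf D0).
  rewrite /F (negPf j0); case: eqVneq => [jD|jD].
    have jE : j = D *+ k.+1.
      by apply/(addIr D); rewrite jD -mulrSr -mulr_natr m0 mulr0.
    by have := F_orbit k; rewrite -jE /F (negPf j0).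
  by rewrite fD ?addrK // -subr_eq0 addrK.
have := sum_periodic D0 FD; rewrite (bigD1 0) //= {1}/F eqxx => /eqP.
rewrite addrC addr_eq0 => /eqP; rewrite (eq_bigr f) => [->|j /negPf]; last by rewrite /F => ->.
by rewrite oppr_eq0.
Qed.

(** [alpha] and [beta] are the exponents of [a] in the sections, at the letters
    [0] and [-D], of a product of conjugates of [b] whose own copies of [b] sit
    at other letters.  The index [2 D] gives such a pair unless [eps (2 D)] and
    [eps D] agree modulo [p]; then an index [j] where [D]-periodicity fails, on
    its own or added to [2 D], does.  By [sum_almost_periodic] there is one.
    The index [2 D] is admissible when [2 D] is not [0]; as the sum is zero, the
    unique element of order two cannot be the only index of a unit. *)
Lemma exists_separating_pair (eps : Z -> Z) :
    \sum_(j | j != 0) residue (eps j) = 0 ->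
    (exists2 j, j != 0 & residue (eps j) != 0) ->
  exists D j1 j2 (c : nat),
    let alpha := eps j1 + eps j2 *+ c in
    let beta := eps (j1 - D) + eps (j2 - D) *+ c in
    [/\ D != 0, eps D \is a GRing.unit,
        [/\ j1 != 0, j1 != D, j2 != 0 & j2 != D],
        residue beta != 0 & residue alpha != residue beta].
Proof.
move=> sum0 [D0 D00 fD0]; pose f j := residue (eps j).
have [D [D_0 fD DD]] : exists D, [/\ D != 0, f D != 0 & D + D != 0].
  have [DD0|?] := eqVneq (D0 + D0) 0; last by exists D0.
  have [/existsP[D1 /and3P[D10 D1D0 fD1]]|] :=
    boolP [exists j, [&& j != 0, j != D0 & f j != 0]].
    exists D1; split=> //; apply: contra D1D0 => /eqP DD1; apply/eqP/val_inj.
    have double (x : Z) : x != 0 -> x + x = 0 -> (x + x = k.+2)%N.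
      move=> x0 /(congr1 val) /= /eqP /dvdnP[[|[|q]]].
      - by rewrite mul0n => /eqP; rewrite addn_eq0 andbb => /eqP x0'; case/negP: x0; apply/eqP/val_inj.
      - by rewrite mul1n.
      - by have := ltn_ord x; nia.
    by have := double _ D00 DD0; have := double _ D10 DD1 => /=; lia.
  rewrite negb_exists => /forallP f0; move: sum0.
  rewrite (bigD1 D0) //= big1 ?addr0 => [/eqP|j /andP[j0 jD0]]; first by rewrite (negPf fD0).
  by apply/eqP; have := f0 j; rewrite j0 jD0 /= negbK.
have fDB : f (D + D - D) = f D by rewrite addrK.
have DDD : D + D != D by rewrite -subr_eq0 addrK.
have [f2D|f2D] := eqVneq (f (D + D)) (f D); last first.
  exists D, (D + D), (D + D), 0%N; rewrite /= !mulr0n !addr0 addrK.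
  by split=> //; apply: residue_unit.
have [/existsP[j /and3P[j0 jD fj]]|] :=
    boolP [exists j, [&& j != 0, j != D & f j != f (j - D)]]; last first.
  rewrite negb_exists => /forallP fper.
  suff: \sum_(j | j != 0) f j != 0 by rewrite sum0 eqxx.
  apply: (@sum_almost_periodic _ D) => // j j0 jD.
  by apply/eqP; have := fper j; rewrite j0 jD negbK.
have [fjD|fjD] := eqVneq (f (j - D)) 0; last first.
  exists D, j, j, 0%N; rewrite /= !mulr0n !addr0.
  by split=> //; apply: residue_unit.
exists D, (D + D), j, 1%N; rewrite /= !mulr1n addrK !residueD.
rewrite -/(f D) -/(f (D + D)) -/(f j) -/(f (j - D)) f2D fjD addr0; split=> //.
  exact: residue_unit.
by rewrite -subr_eq0 [_ + f j]addrC addrK -fjD.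
Qed.

End ModP.

(** * GGS-groups *)

Section GGS.
Local Open Scope classical_set_scope.
Local Open Scope group_scope.
Variables (k : nat) (e : 'rV['Z_k.+2]_k.+1).
Local Notation Z := 'I_k.+2.
Implicit Types (x y s t u : Z) (f g h : tree_aut 'I_k.+2).
Local Notation a := (@GGS_a k.+2).
Local Notation b := (@GGS_b k.+2 e).
Local Notation G := (@GGS_group k.+2 e).

(** Exponents of [a] live in [Z/m]; [apow] turns addition there into
    multiplication of automorphisms. *)
Definition apow (t : Z) : tree_aut 'I_k.+2 := a ^+ t.

(** The defining vector indexed by [Z/m], with the value [0] at [0]: the
    section of [b] at the letter [x] is [a ^ (eps (x + 1))] unless [x + 1 = 0],
    and that of its conjugate [conj_b s] at [x] is [a ^ (eps (x - s))] unless
    [x = s]. *)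
Definition eps (t : Z) : Z :=
  if insub (val (t - 1)%R) is Some i then e ord0 i else 0%R.

Definition conj_b (s : Z) : tree_aut 'I_k.+2 := b ^ apow (s + 1)%R.

Let m0 : (k.+2%:R = 0 :> Z)%R := @pchar_Zp k.+2 isT.

Let natZ (t : Z) : ((t : nat)%:R = t)%R. Proof. exact: natr_Zp. Qed.

Lemma insub_last t : (insub (val t) : option 'I_k.+1) = None -> (t + 1 = 0)%R.
Proof.
case: insubP => // le_t _; apply: val_inj => /=.
have -> : (t : nat) = k.+1.
  by apply/eqP; rewrite eqn_leq -ltnS ltn_ord leqNgt.
by rewrite addn1 modnn.
Qed.

Lemma eps0 : eps 0%R = 0%R.
Proof.
rewrite /eps sub0r; case: insubP => //= i; rewrite modn_small ?subn1 //=.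
by rewrite ltnn.
Qed.

Lemma letter_a x : letter a x = (x + 1)%R.
Proof. by apply: val_inj; rewrite /= addn1. Qed.

Lemma section_a x : section a [:: x] = 1.
Proof. exact: section_eq. Qed.

Lemma letter_aX i x : letter (a ^+ i) x = (x + i%:R)%R.
Proof.
elim: i x => [|i IHi] x; first by rewrite addr0.
by rewrite expgS letterM letter_a IHi -addrA mulrS.
Qed.

Lemma section_aX i x : section (a ^+ i) [:: x] = 1.
Proof.
elim: i x => [|i IHi] x; first exact: section1.
by rewrite expgS sectionM section_a tree_aut_letter IHi mul1g.
Qed.

Lemma letter_apow t x : letter (apow t) x = (x + t)%R.
Proof. by rewrite letter_aX natZ. Qed.

Lemma section_apow t x : section (apow t) [:: x] = 1.
Proof. exact: section_aX. Qed.

Lemma a_order : a ^+ k.+2 = 1.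
Proof.
apply: st1_ext => [||x]; last by rewrite section_aX section1.
  by apply: st1_letter => x; rewrite letter_aX m0 addr0.
by apply: st1_letter.
Qed.

Lemma apowD s t : apow (s + t)%R = apow s * apow t.
Proof. by rewrite /apow -expgnDr; apply: (expg_modn _ a_order). Qed.

Lemma apow0 : apow 0%R = 1. Proof. by []. Qed.

Lemma apow1 : apow 1%R = a. Proof. by []. Qed.

Lemma apowN t : apow (- t)%R = (apow t)^-1.
Proof. by apply/eqP; rewrite -mulg_eq1 -apowD addNr. Qed.

Lemma apowX t i : apow t ^+ i = apow (t *+ i)%R.
Proof. by elim: i => // i IHi; rewrite expgS IHi mulrS apowD. Qed.

Lemma apowX_nat t s : apow t ^+ s = apow (t * s)%R.
Proof. by rewrite apowX -mulr_natr natZ. Qed.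

Lemma apow_commute s t : commute (apow s) (apow t).
Proof. by rewrite /commute -!apowD addrC. Qed.

Lemma section_b x :
  section b [:: x] = if (x + 1 == 0)%R then b else apow (eps (x + 1)%R).
Proof.
have := psi_GGS_b e => /ffunP/(_ x); rewrite !ffunE => ->.
rewrite /eps addrK; case E: insub => [i|]; last by rewrite insub_last ?eqxx.
case: eqP => // /(congr1 val) /= /eqP; move: E; case: insubP => // j lt_x _ _.
by rewrite addn1 modn_small.
Qed.

Lemma section_conj_apow f t x : section (f ^ apow t) [:: x] = section f [:: (x - t)%R].
Proof.
rewrite /conjg -apowN !sectionM section_apow tree_aut_letter letter_apow mul1g.
by rewrite (tree_aut_letter f) section_apow mulg1.
Qed.

Lemma conj_st1 f g : st1 f -> st1 (f ^ g).
Proof.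
move=> sf; apply: st1_letter => x.
by rewrite /conjg !letterM (letter_st1 _ sf) letterVK.
Qed.

Lemma conj_b_st1 s : st1 (conj_b s).
Proof. exact/conj_st1/GGS_b_st1. Qed.

Lemma section_conj_b s x :
  section (conj_b s) [:: x] = if x == s then b else apow (eps (x - s)%R).
Proof.
rewrite section_conj_apow section_b.
by rewrite opprD addrA subrK subr_eq0.
Qed.

Lemma G_subgroup : subgroup G. Proof. exact: generated_subgroup. Qed.

Let sG := G_subgroup.

Lemma G_a : G a. Proof. by apply: mem_generated; left. Qed.

Lemma G_b : G b. Proof. by apply: mem_generated; right. Qed.

Lemma G_apow t : G (apow t). Proof. exact: (subgroupX sG _ G_a). Qed.

Lemma G_conj_b s : G (conj_b s). Proof. exact: (subgroupJ sG G_b (G_apow _)). Qed.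

Lemma section_G f (w : seq Z) : G f -> G (section f w).
Proof.
suff G1 g x : G g -> G (section g [:: x]).
  elim: w f => [|x w IHw] f Gf.
    by have -> : section f [::] = f by apply: section_eq => z; rewrite tree_aut_nil.
  by rewrite -[x :: w]cat1s section_cat; apply: IHw; apply: G1.
suff: G `<=` [set g | forall x, G (section g [:: x])] by move=> GS Gg; apply: GS.
apply: generated_min => [|_ [->|->] y].
- apply/subgroupP; split=> [y|g1 h Gg Gh y|g1 Gg y].
  + by rewrite section1; apply: (subgroup1 sG).
  + by rewrite sectionM tree_aut_letter; apply: (subgroupM sG); [apply: Gg|apply: Gh].
  + rewrite -[y](letterVK g1) -tree_aut_letter sectionV.
    by apply: (subgroupV sG); apply: Gg.
- by rewrite section_a; apply: (subgroup1 sG).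
- by rewrite section_b; case: ifP => _; [apply: G_b|apply: G_apow].
Qed.

(** The sections at a given letter already generate [G] on the stabiliser of
    the first level, since some conjugate of [b] has there a power of [a] with
    invertible exponent. *)
Lemma G_fractal D : D != 0%R -> eps D \is a GRing.unit ->
  forall x g, G g -> exists h, [/\ G h, st1 h & section h [:: x] = g].
Proof.
move=> D0 uD x; apply: generated_min => [|_ [->|->]] /=.
- apply/subgroupP; split=> [|g g' [h [Gh sh <-]] [h' [Gh' sh' <-]]|g [h [Gh sh <-]]].
  + by exists 1; split; [apply: (subgroup1 sG)|apply: (subgroup1 (@st1_subgroup _))|apply: section1].
  + exists (h * h'); split; first exact: (subgroupM sG).
      exact: (subgroupM (@st1_subgroup _)).
    exact: section_st1M.
  + exists h^-1; split; first exact: (subgroupV sG).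
      exact: (subgroupV (@st1_subgroup _)).
    exact: section_st1V.
- exists (conj_b (x - D)%R ^+ ((eps D)^-1)%R); split.
  + exact: (subgroupX sG _ (G_conj_b _)).
  + exact: (subgroupX (@st1_subgroup _) _ (@conj_b_st1 _)).
  + rewrite sectionX_fix ?conj_b_st1 // section_conj_b subKr.
    by rewrite eq_sym -subr_eq0 addrAC subrr add0r oppr_eq0 (negPf D0) apowX_nat divrr.
- by exists (conj_b x); rewrite section_conj_b eqxx; split=> //; [apply: G_conj_b|apply: conj_b_st1].
Qed.

(** For an invertible exponent [u], the power [(a^u b)^m] fixes the last letter
    and has there the section [a^(sum eps) b].  So if [sum eps] is invertible,
    then [a^u b] reproduces itself and has infinite order. *)
Lemma apow_b_infinite_order (u : Z) i :
    (\sum_t eps t)%R \is a GRing.unit -> u \is a GRing.unit ->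
  (apow u * b) ^+ i.+1 <> 1.
Proof.
move=> uS; have [n] := ubnP i; elim: n i u => // n IHn i u lt_i_n uu.
set f := apow u * b => f_i.
have letter_f x j : letter (f ^+ j) x = (x + u *+ j)%R.
  elim: j x => [|j IHj] x; first by rewrite addr0.
  rewrite expgSr letterM IHj letterM letter_apow (letter_st1 _ (@GGS_b_st1 _ e)).
  by rewrite mulrSr addrA.
have mul_u_eq0 j : (u *+ j == 0)%R = (k.+2 %| j)%N.
  rewrite -mulr_natr -(mulr0 u) (inj_eq (mulrI uu)).
  by rewrite -(inj_eq val_inj) /= (val_Zp_nat (isT : 1 < k.+2)).
have section_fS j : section (f ^+ j.+1) [:: (-1)%R] =
    section (f ^+ j) [:: (-1)%R] * section b [:: (-1 + u *+ j.+1)%R].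
  rewrite expgSr sectionM tree_aut_letter letter_f sectionM section_apow mul1g.
  by rewrite tree_aut_letter letter_apow mulrSr addrA.
have section_f j : (j < k.+2)%N ->
    section (f ^+ j) [:: (-1)%R] = apow (\sum_(0 <= l < j.+1) eps (u *+ l))%R.
  elim: j => [|j IHj] lt_j; first by rewrite section1 big_nat1 mulr0n eps0.
  rewrite section_fS IHj ?(ltnW lt_j) // section_b [(-1 + _)%R]addrC subrK mul_u_eq0.
  by rewrite gtnNdvd // -apowD [in RHS]big_nat_recr.
have /dvdnP[[|j] ij] : (k.+2 %| i.+1)%N.
    by rewrite -mul_u_eq0 -[X in X == _]add0r -letter_f f_i.
  by rewrite mul0n in ij.
apply: (IHn j (\sum_t eps t)%R) => //; first by nia.
have f_m : section (f ^+ k.+2) [:: (-1)%R] = apow (\sum_t eps t)%R * b.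
  rewrite section_fS section_f // section_b [(-1 + _)%R]addrC subrK mul_u_eq0 dvdnn.
  congr (apow _ * b); rewrite big_mkord [RHS](reindex_inj (mulrI uu)).
  by apply: eq_bigr => t _; rewrite -mulr_natr natZ.
rewrite -f_m -sectionX_fix; first by rewrite -expgnA mulnC -ij f_i section1.
by rewrite tree_aut_letter letter_f -mulr_natr m0 mulr0 addr0.
Qed.

Lemma level_transitive_G D : D != 0%R -> eps D \is a GRing.unit -> level_transitive G.
Proof.
move=> D0 uD l; elim: l => [|l IHl] [|x u] // [|y v] // => [_ _|[su] [sv]].
  by exists 1; [apply: (subgroup1 sG)|].
have [g Gg gu] := IHl u v su sv; have [h [Gh sh hg]] := G_fractal D0 uD y Gg.
exists (apow (y - x)%R * h); first exact: (subgroupM sG (G_apow _)).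
rewrite tree_autME tree_aut_cons letter_apow section_apow addrC subrK.
by rewrite tree_aut_cons letter_st1 // hg tree_aut1E gu.
Qed.

End GGS.

(** * Copies of gamma_3 inside gamma_3 *)

Section Branching.
Local Open Scope classical_set_scope.
Local Open Scope group_scope.
Variables (k : nat) (e : 'rV['Z_k.+2]_k.+1).
Local Notation Z := 'I_k.+2.
Implicit Types (x y f g h : tree_aut 'I_k.+2) (s t r : Z).
Local Notation a := (@GGS_a k.+2).
Local Notation b := (@GGS_b k.+2 e).
Local Notation G := (@GGS_group k.+2 e).
Local Notation G' := (commg_subgroup G G).
Local Notation K := (lower_central 3 G).
Local Notation eps := (eps e).
Local Notation conj_b := (conj_b e).

Let sG : subgroup G := G_subgroup e.
Let sK : subgroup K := (gamma3_normalised sG).1.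
Let KJ x g : K x -> G g -> K (x ^ g). Proof. exact: (gamma3_normalised sG).2. Qed.
Let sst : subgroup (@st1 Z) := @st1_subgroup Z.

Lemma conj_bR s t : s != t ->
  [~ conj_b s, conj_b t] =
    tree_at s [~ b, apow (eps (s - t)%R)] * tree_at t [~ apow (eps (t - s)%R), b].
Proof.
move=> st; have sb u : st1 (conj_b u) := @conj_b_st1 _ e u.
have sat u f : st1 (tree_at u f) := @tree_at_st1 _ u f.
apply: st1_ext => [||r]; [exact: (subgroupR sst)|exact: (subgroupM sst)|].
rewrite section_st1R // [RHS]section_st1M //.
rewrite !section_tree_at !section_conj_b; have [->|rs] := eqVneq r s.
  by rewrite (negPf st) mulg1.
have [->|rt] := eqVneq r t; first by rewrite mul1g.
by rewrite mulg1; apply/eqP/commgP/apow_commute.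
Qed.

Lemma normalised_commutator_a N x u : normalised_by G N -> u \is a GRing.unit ->
  N [~ x, apow u] -> N [~ x, a].
Proof.
move=> nN uu Nxu.
have [] := subgroupX (centraliser_mod_subgroup sG nN x) u^-1%R (conj (@G_apow _ e u) Nxu).
by rewrite apowX_nat divrr // apow1.
Qed.

(** As [conj_b t] is [conj_b s] times an element of the derived subgroup, this is
    also the commutator of [conj_b s] with that element. *)
Lemma conj_bR_gamma3 s t : K [~ conj_b s, conj_b t].
Proof.
have -> : conj_b t = conj_b s * [~ conj_b s, apow (t - s)%R].
  rewrite /commg mulVKg /conj_b -conjgM -apowD; congr (_ ^ apow _).
  by rewrite [RHS]addrC addrA subrK.
rewrite commgMl_self -invgR; apply: (subgroupV sK); apply: gamma3R.
  by apply: derivedR; [apply: G_conj_b|apply: G_apow].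
exact: G_conj_b.
Qed.

Lemma gamma3_shift s t f g r : K (tree_at s f * tree_at t g) ->
  K (tree_at (s + r)%R f * tree_at (t + r)%R g).
Proof.
by move/KJ/(_ (@G_apow _ e r)); rewrite conjMg !tree_atJ !section_apow !conjg1 !letter_apow.
Qed.

Lemma gamma3_at_shift s f t : K (tree_at s f) -> K (tree_at t f).
Proof.
move=> Kf; have := @gamma3_shift s s f 1 (t - s)%R.
by rewrite !tree_at1 !mulg1 addrC subrK; apply.
Qed.

Variable D : Z.
Hypotheses (D_neq0 : D != 0%R) (D_unit : eps D \is a GRing.unit).

Definition branch_part : set (tree_aut Z) := [set x | K (tree_at 0%R x)].

Lemma branch_part_normalised : normalised_by G branch_part.
Proof.
split.
  apply/subgroupP; rewrite /branch_part; split=> [|x y|x] /=.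
  - by rewrite tree_at1; apply: (subgroup1 sK).
  - by rewrite tree_atM; apply: (subgroupM sK).
  - by rewrite tree_atV; apply: (subgroupV sK).
move=> x g Lx Gg; have [h [Gh sh <-]] := G_fractal D_neq0 D_unit 0%R Gg.
by have := KJ Lx Gh; rewrite tree_atJ letter_st1.
Qed.

Let sL : subgroup branch_part := branch_part_normalised.1.
Let LJ x g : branch_part x -> G g -> branch_part (x ^ g).
Proof. exact: branch_part_normalised.2. Qed.

(** The inverse of [y] makes consecutive links cancel in [linked_chain]. *)
Definition linked x y : Prop := K (tree_at 0%R x * tree_at (- D)%R y^-1).

Let D0 : (- D)%R != 0%R. Proof. by rewrite oppr_eq0. Qed.

Lemma linkedJ x y h : G h -> st1 h -> linked x y ->
  linked (x ^ section h [:: 0%R]) (y ^ section h [:: (- D)%R]).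
Proof.
move=> Gh sh /KJ/(_ Gh); rewrite conjMg !tree_atJ !letter_st1 //.
by rewrite /linked conjVg.
Qed.

Lemma linked_commutator :
  linked [~ b, apow (eps D)] [~ b, apow (eps (- D)%R)].
Proof.
have := conj_bR_gamma3 0%R (- D)%R.
by rewrite conj_bR 1?eq_sym // sub0r opprK subr0 /linked invgR.
Qed.

(** The elements linked to some element of [G'] form a subgroup normalised by
    [G], because sections at [0] of the stabiliser exhaust [G]; it contains
    [[b, a]] because [eps D] is invertible. *)
Lemma linked_total x : G' x -> exists2 y, G' y & linked x y.
Proof.
have sG' := (derived_normalised sG).1; have G'J := (derived_normalised sG).2.
pose P := [set x | exists2 y, G' y & linked x y].
have nP : normalised_by G P.
  split.
    apply/subgroupP; split=> [|u v [y G'y uy] [z G'z vz]|u [y G'y uy]].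
    - exists 1; first exact: (subgroup1 sG').
      by rewrite /linked invg1 !tree_at1 mulg1; apply: (subgroup1 sK).
    - exists (z * y); first exact: (subgroupM sG').
      have := subgroupM sK uy vz.
      rewrite /linked invgM !tree_atM !mulgA -[_ * _ * tree_at 0%R v]mulgA.
      by rewrite (tree_at_commute _ _ D0) !mulgA.
    - exists y^-1; first exact: (subgroupV sG').
      have := subgroupV sK uy; rewrite /linked invgM !tree_atV invgK.
      by rewrite -tree_atV (tree_at_commute _ _ D0).
  move=> u g [y G'y uy] Gg; have [h [Gh sh hg]] := G_fractal D_neq0 D_unit 0%R Gg.
  exists (y ^ section h [:: (- D)%R]); last by rewrite -hg; apply: linkedJ.
  by apply: G'J => //; apply: section_G.
have Pba : P [~ b, a].
  apply: (normalised_commutator_a nP D_unit).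
  exists [~ b, apow (eps (- D)%R)]; last exact: linked_commutator.
  exact: (derivedR (@G_b _ e) (@G_apow _ e _)).
apply: (derived_subset nP) => _ _ [->|->] [->|->]; rewrite ?commgg //;
  try exact: (subgroup1 nP.1).
by rewrite -invgR; apply: (subgroupV nP.1).
Qed.

Section Centrality.
Variables (p n : nat).
Hypotheses (p_pr : prime p) (def_m : k.+2 = (p ^ n)%N).
Variables (j1 j2 : Z) (c : nat).
Let alpha : Z := (eps j1 + eps j2 *+ c)%R.
Let beta : Z := (eps (j1 - D) + eps (j2 - D) *+ c)%R.
Hypotheses (j1_neq0 : j1 != 0%R) (j1_neqD : j1 != D).
Hypotheses (j2_neq0 : j2 != 0%R) (j2_neqD : j2 != D).
Hypotheses (beta_neq0 : residue p beta != 0%R).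
Hypotheses (alpha_beta : residue p alpha != residue p beta).

(** Conjugation by a product of conjugates of [b]: as neither [0] nor [-D] is
    [-j1] or [-j2], its sections at [0] and [-D] are powers of [a]. *)
Lemma linked_apow x y s : linked x y ->
  linked (x ^ apow (alpha * s)%R) (y ^ apow (beta * s)%R).
Proof.
pose h := (conj_b (- j1)%R * conj_b (- j2)%R ^+ c) ^+ s.
have Gh : G h.
  apply: (subgroupX sG); apply: (subgroupM sG); first exact: G_conj_b.
  exact: (subgroupX sG _ (@G_conj_b _ e _)).
have sb t : st1 (conj_b t) := @conj_b_st1 _ e t.
have sh0 : st1 (conj_b (- j1)%R * conj_b (- j2)%R ^+ c).
  by apply: (subgroupM sst) => //; apply: (subgroupX sst).
have sh : st1 h by apply: (subgroupX sst).
have hE t : t != (- j1)%R -> t != (- j2)%R -> section h [:: t] =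
    apow ((eps (t + j1) + eps (t + j2) *+ c) * s)%R.
  move=> tj1 tj2; rewrite (sectionX_fix _ (sh0 t)) section_st1M // (sectionX_fix _ (sb _ t)).
  by rewrite !section_conj_b (negPf tj1) (negPf tj2) !opprK apowX -apowD apowX_nat.
move=> /(linkedJ Gh sh); rewrite !hE ?add0r //.
- by rewrite ![(- D + _)%R]addrC.
- by rewrite eqr_opp eq_sym.
- by rewrite eqr_opp eq_sym.
- by rewrite eq_sym oppr_eq0.
- by rewrite eq_sym oppr_eq0.
Qed.

Let lambda : Z := (alpha / beta)%R.

Let linked_apow1 x y s : linked x y ->
  linked (x ^ apow (lambda * s)%R) (y ^ apow s).
Proof.
have ub : beta \is a GRing.unit by exact: (residue_unit p_pr def_m).
by move/(linked_apow (beta^-1 * s)%R); rewrite !mulrA divrr // mul1r.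
Qed.

(** The element [y] must not depend on [s]: only so can the ends of the chains
    of different conjugates of [x] be compared. *)
Lemma linked_chain i x : G' x -> exists2 y, G' y & forall s,
  K (tree_at 0%R (x ^ apow (lambda ^+ i * s)%R) * tree_at (- D *+ i)%R (y ^ apow s)^-1).
Proof.
move=> G'x; elim: i => [|i [y G'y xy]].
  exists x => // s; rewrite mulr0n expr0 mul1r tree_atV mulgV.
  exact: (subgroup1 sK).
have [z G'z yz] := linked_total G'y; exists z => // s.
have := subgroupM sK (xy (lambda * s)%R) (gamma3_shift (- D *+ i)%R (linked_apow1 s yz)).
rewrite add0r -mulrS mulrA -exprSr; congr K.
by rewrite !tree_atV !mulgA mulgVK.
Qed.

(** After [m] links the chain is back at the letter [0].  Taking [s = 0] and
    [s = 1], and conjugating the first by [a], shows that [x^(a^(lambda^m))] and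
    [x^a] are both [y^a] modulo [branch_part]; so [x] commutes with a power of
    [a] whose exponent [lambda^m - 1] is congruent to [lambda - 1] modulo [p],
    hence invertible. *)
Lemma derived_commutes_a x : G' x -> branch_part [~ x, a].
Proof.
move=> G'x; have Gx := derived_sub sG G'x.
have m0 : (k.+2%:R = 0 :> Z)%R := @pchar_Zp k.+2 isT.
have [y _ xy] := linked_chain k.+2 G'x.
have {}xy s : branch_part (x ^ apow (lambda ^+ k.+2 * s)%R * (y ^ apow s)^-1).
  by have := xy s; rewrite -mulr_natr m0 mulr0 -tree_atM.
pose mu := (lambda ^+ k.+2 - 1)%R.
have mu_unit : mu \is a GRing.unit.
  apply: (residue_unit p_pr def_m).
  rewrite (residueB p_pr def_m) (residueXm p_pr def_m) residue1 subr_eq0.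
  apply: contra alpha_beta => /eqP l1.
  have ub : beta \is a GRing.unit by exact: (residue_unit p_pr def_m).
  by rewrite -[alpha](divrK ub) (residueM p_pr def_m) -/lambda l1 mul1r.
have L1 : branch_part (x ^ apow (lambda ^+ k.+2)%R * (x ^ a)^-1).
  have := subgroupM sL (xy 1%R) (subgroupV sL (LJ (xy 0%R) (@G_a _ e))).
  by rewrite mulr1 apow1 mulr0 apow0 !conjg1 conjMg conjVg [(x ^ a * _)^-1]invgM invgK divgKA.
have Lmu : branch_part [~ x, apow mu].
  have GaV : G a^-1 by apply: (subgroupV sG); apply: G_a.
  have -> : [~ x, apow mu] = ((x ^ apow (lambda ^+ k.+2)%R * (x ^ a)^-1) ^ a^-1) ^ x.
    by rewrite /mu apowD apowN apow1 /commg /conjg !gnorm.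
  exact: LJ (LJ L1 GaV) Gx.
exact: (normalised_commutator_a branch_part_normalised mu_unit).
Qed.

Lemma derived_commutes_apow x s : G' x -> branch_part [~ x, apow s].
Proof.
move=> G'x.
have [] // := subgroupX (centraliser_mod_subgroup sG branch_part_normalised x) s
  (conj (@G_a _ e) (derived_commutes_a G'x)).
Qed.

(** Modulo [branch_part], the commutator [[b, a^u]] with [u = eps D] commutes
    with [a]; the commutator of the linked pair with [conj_b 0] shows that it
    also commutes with [b], so it is central and [G'] with it. *)
Lemma gamma3_sub_branch_part : K `<=` branch_part.
Proof.
have nL := branch_part_normalised.
pose x := [~ b, apow (eps D)]; pose y := [~ apow (eps (- D)%R), b].
have G'x : G' x by exact: (derivedR (@G_b _ e) (@G_apow _ e _)).
have G'y : G' y by exact: (derivedR (@G_apow _ e _) (@G_b _ e)).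
have Lxb : branch_part [~ x, b].
  pose z := tree_at 0%R x * tree_at (- D)%R y.
  have Kz : K z.
    have := conj_bR_gamma3 0%R (- D)%R.
    by rewrite conj_bR 1?eq_sym // sub0r opprK subr0.
  have : K [~ z, conj_b 0%R].
    exact: (subgroupM sK (subgroupV sK Kz) (KJ Kz (@G_conj_b _ e _))).
  rewrite /z tree_at_pairR; [|by rewrite eq_sym|exact: conj_b_st1].
  rewrite !section_conj_b eqxx (negPf D0) subr0.
  move=> Kxy; have Ky := gamma3_at_shift (- D)%R (derived_commutes_apow (eps (- D)%R) G'y).
  by have := subgroupM sK Kxy (subgroupV sK Ky); rewrite mulgK.
have Cx : centre_mod G branch_part x.
  split=> [|g Gg]; first exact: (derived_sub sG G'x).
  apply: (centraliser_mod_generated nL _ Gg) => _ [->|->] //.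
  exact: derived_commutes_a.
have nC := centre_mod_normalised sG nL.
have Cba := normalised_commutator_a nC D_unit Cx.
have G'C : G' `<=` centre_mod G branch_part.
  apply: (derived_subset nC) => _ _ [->|->] [->|->]; rewrite ?commgg //;
    try exact: (subgroup1 nC.1).
  by rewrite -invgR; apply: (subgroupV nC.1).
by apply: generated_min => // _ [u /G'C[_ Cu] [v Gv <-]]; apply: Cu.
Qed.

End Centrality.

(** Otherwise [[b_0, b_(-D)]] is trivial, so [b] commutes with [a] and equals all
    its conjugates by powers of [a]; two of these have the sections [b] and
    [a^(eps D)] at the same letter, whereas [a^(eps D)] moves the first level. *)
Lemma gamma3_neq1 : K <> [set 1].
Proof.
move=> K1; have n1 : normalised_by G K by exact: gamma3_normalised.
have K1E f : K f -> f = 1 by rewrite K1.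
have bu : [~ b, apow (eps D)] = 1.
  have := K1E _ (conj_bR_gamma3 0%R (- D)%R).
  rewrite conj_bR 1?eq_sym // sub0r opprK subr0.
  move/(congr1 (fun f => section f [:: 0%R])); rewrite section1.
  rewrite section_st1M; last exact: tree_at_st1.
  by rewrite !section_tree_at eqxx eq_sym (negPf D0) mulg1.
have ba : [~ b, a] = 1.
  apply: K1E; apply: (normalised_commutator_a n1 D_unit); rewrite bu.
  exact: (subgroup1 sK).
have b_conj s : conj_b s = b.
  by apply/conjg_fixP/commgP; apply: commuteX; apply/commgP/eqP.
have := section_conj_b e (- D)%R 0%R.
rewrite b_conj -{1}(b_conj 0%R) section_conj_b eqxx.
rewrite eq_sym (negPf D0) sub0r opprK => bE.
have := letter_st1 0%R (@GGS_b_st1 _ e); rewrite bE letter_apow add0r => eps0.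
by move: D_unit; rewrite eps0 unitr0.
Qed.

Lemma derived_st1 : G' `<=` @st1 Z.
Proof.
have nst : normalised_by G (@st1 Z) by split=> // x g sx _; apply: conj_st1.
have sba : st1 [~ b, a].
  by apply: (subgroupM sst); [apply: (subgroupV sst)|apply: conj_st1]; apply: GGS_b_st1.
apply: (derived_subset nst) => _ _ [->|->] [->|->]; rewrite ?commgg //;
  try exact: (subgroup1 sst).
by rewrite -invgR; apply: (subgroupV sst).
Qed.

(** A tuple of elements of [K] is the product of its components, each of which
    lies in [K] when copied at its own letter. *)
Lemma psi_branch_part : K `<=` branch_part ->
  [set q : {ffun Z -> tree_aut Z} | forall t, K (q t)] `<=` (@psi Z) @` K.
Proof.
move=> KL q /= Kq.
have [f [Kf sf fE]] : exists f, [/\ K f, st1 f &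
    forall t, section f [:: t] = if t \in enum 'I_k.+2 then q t else 1].
  elim: (enum _) (enum_uniq 'I_k.+2) => [_|r rs IHrs /= /andP[r_rs /IHrs[f [Kf sf fE]]]].
    exists 1; split; [exact: (subgroup1 sK)|exact: (subgroup1 sst)|].
    by move=> t; rewrite section1.
  exists (tree_at r (q r) * f); split.
  - by apply: (subgroupM sK) => //; apply: gamma3_at_shift (KL _ (Kq r)).
  - by apply: (subgroupM sst) => //; apply: tree_at_st1.
  move=> t; rewrite section_st1M; last exact: tree_at_st1.
  rewrite section_tree_at fE in_cons; case: eqP => [->|_]; last by rewrite mul1g.
  by rewrite (negPf r_rs) mulg1.
exists f => //; apply/ffunP => t; rewrite ffunE fE.
by rewrite mem_enum.
Qed.

End Branching.

(** * Periodic GGS-groups *)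

Section Periodic.
Local Open Scope classical_set_scope.
Local Open Scope group_scope.
Variables (p n k : nat) (e : 'rV['Z_k.+2]_k.+1).
Hypotheses (p_pr : prime p) (def_m : k.+2 = (p ^ n)%N).
Local Notation G := (@GGS_group k.+2 e).
Hypothesis perG : periodic G.

Lemma periodic_sum_eps : (\sum_(j | j != 0) residue p (eps e j) = 0)%R.
Proof.
rewrite -(residue_sum p_pr def_m); apply/eqP/negPn/negP => S0.
have uS : (\sum_t eps e t)%R \is a GRing.unit.
  by rewrite (bigD1 0%R) //= eps0 add0r; apply: (residue_unit p_pr def_m).
have [i i_gt0] := perG (subgroupM (G_subgroup e) (@G_apow _ e 1%R) (@G_b _ e)).
by case: i i_gt0 => // i _; apply: apow_b_infinite_order uS (unitr1 _).
Qed.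

(** The index of [eps] is one more than that of [e] read as a letter. *)
Lemma nonmultiple_eps :
    ~ (forall i, exists c : 'Z_k.+2, e ord0 i = (p%:R * c)%R) ->
  exists2 j : 'I_k.+2, j != 0%R & residue p (eps e j) != 0%R.
Proof.
move=> he; apply: contrapT => eps_p; apply: he => i.
pose t : 'I_k.+2 := (widen_ord (leqnSn _) i + 1)%R.
have eps_t : eps e t = e ord0 i.
  rewrite /eps addrK; case: insubP => /= [j _ ji|]; last by rewrite ltn_ord.
  by congr (e _ _); apply: val_inj.
have t0 : t != 0%R.
  by rewrite -(inj_eq val_inj) /= addn1 modn_small // ltnS.
have : residue p (e ord0 i) == 0%R.
  by apply/negPn/negP => r0; apply: eps_p; exists t; rewrite ?eps_t.
rewrite (residue_eq0 p_pr) => /dvdnP[q iq]; exists (q%:R)%R.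
by rewrite -natrM mulnC -iq natr_Zp.
Qed.

Lemma branch_over_gamma3 :
    ~ (forall i, exists c : 'Z_k.+2, e ord0 i = (p%:R * c)%R) ->
  regular_branch_over G (lower_central 3 G).
Proof.
move=> /nonmultiple_eps he.
have [D [j1 [j2 [c [D0 uD [j10 j1D j20 j2D] beta0 alpha_beta]]]]] :=
  exists_separating_pair p_pr def_m periodic_sum_eps he.
have sG := G_subgroup e; have G'st := @derived_st1 _ e.
have K_G' := gamma3_sub_derived sG.
split.
- exact: level_transitive_G D0 uD.
- by move=> g u; apply: section_G.
- split; first exact: (gamma3_normalised sG).1.
    exact: gamma3_neq1 D0 uD.
  by move=> f /K_G' Kf; split; [apply: G'st|apply: (derived_sub sG)].
- apply: psi_branch_part.
  exact: (gamma3_sub_branch_part D0 uD p_pr def_m j10 j1D j20 j2D beta0 alpha_beta).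
- exact: gamma3_finite_index.
Qed.

End Periodic.

Theorem corollary2p12 (p n : nat) (hp : prime p) (hn : (1 <= n)%N)
    (e : 'rV['Z_(p ^ n)]_(p ^ n).-1) (he : defvec_F p n e)
    (hG : periodic (GGS_group e)) :
  regular_branch_over (GGS_group e) (lower_central 3 (GGS_group e)).
Proof.
have m_gt1 : (1 < p ^ n)%N by rewrite -(expn0 p) ltn_exp2l ?prime_gt1.
(* Replacing [p ^ n] with a variable lets it become a double successor in the
   types that depend on it. *)
have gen m (e' : 'rV['Z_m]_m.-1) : m = (p ^ n)%N -> (1 < m)%N ->
    ~ (forall i, exists c : 'Z_m, e' ord0 i = (p%:R * c)%R) ->
    periodic (GGS_group e') ->
  regular_branch_over (GGS_group e') (lower_central 3 (GGS_group e')).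
  by case: m e' => [|[|k]] // e' def_m _ he' perG; exact: (branch_over_gamma3 hp def_m perG he').
exact: gen.
Qed.
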